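(* If $m$ is a non-negative integer, then \[ \sum_{n=1}^\infty\frac{2^{2n}}{n(n+1)(n+2)\binom{2(n+m)}{n+m}\binom{n+m}{m}}=\frac{1}{2\binom{2m}{m}}\left(\left(m-\frac12\right)\left(m+\frac12\right)\left(4O_m^{(2)}-3\zeta(2)\right)+m\right). \] In particular, \[ \sum_{n=1}^\infty\frac{2^{2n}}{n(n+1)(n+2)\binom{2n}{n}}=\frac{\pi^2}{16},\quad \sum_{n=1}^\infty\frac{2^{2n}}{n(n+1)^2(n+2)\binom{2(n+1)}{n+1}}=1-\frac{3\pi^2}{32},\quad \sum_{n=1}^\infty\frac{2^{2n+1}}{n(n+1)^2(n+2)^2\binom{2(n+2)}{n+2}}=\frac{14}{9}-\frac{5\pi^2}{32}. \]
   Context: $\zeta$ is the Riemann zeta function. For nonnegative integer $m$, $O_m^{(2)}=\sum_{j=1}^m(2j-1)^{-2}$ (empty sum $=0$). *)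

(* Defs.v *)
From Stdlib Require Import Reals.
From Coquelicot Require Import Coquelicot.
Open Scope R_scope.

(* The series a 1 + a 2 + ... converges, with sum l. *)
Definition is_series1 (a : nat -> R) (l : R) : Prop :=
  is_series (fun k : nat => a (S k)) l.

(* The Riemann zeta function for a real argument s > 1, where it is the sum of
   its Dirichlet series; for s <= 1 the value is not meaningful. *)
Definition zeta (s : R) : R :=
  Series (fun k : nat => / Rpower (INR (S k)) s).

(* [sum_n_m] from 1 to 0 is the empty sum, so [O2 0 = 0]. *)
Definition O2 (m : nat) : R :=
  sum_n_m (fun j : nat => / (2 * INR j - 1) ^ 2) 1 m.

(* The name [C] alone would refer to Coquelicot's complex numbers. *)
Notation binom := Binomial.C (only parsing).

(* Main.v *)
(** Multiplied by [2 binom (2m) m / (m^2 - 1/4)], the summand becomes a function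
    F(m, n) with a Wilf-Zeilberger mate: F(m+1, n) - F(m, n) is the n-difference
    of 2 (n + 2) / (2 m + 3) F(m, n).  Hence the normalised sums A_m satisfy a
    first-order recurrence, which makes A_m - 4 O_m - 4m / (4m^2 - 1) constant.
    Since A_m tends to 0, the constant is minus four times the limit of O_m,
    that is, minus 3 zeta(2).  The special cases also use zeta(2) = pi^2 / 6: by
    duplication, the sum of 1/sin^2 over the N angles (2j - 1) pi / (4N) is 2N^2
    when N is a power of 2, and 1/sin^2 x - 1 < 1/x^2 < 1/sin^2 x. *)
Require Import Defs.
From Stdlib Require Import Arith Reals Lra Lia.
From Coquelicot Require Import Coquelicot.
Open Scope R_scope.

(** * Finite sums, telescoping series and the limit of the odd sums *)

Lemma sum_n_m_1_S (f : nat -> R) (n : nat) :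
  sum_n_m f 1 (S n) = sum_n_m f 1 n + f (S n).
Proof. rewrite sum_n_Sm by lia. reflexivity. Qed.

Lemma sum_n_m_rev (f : nat -> R) (n : nat) : forall a : nat,
  sum_n_m f (S a) (a + n) = sum_n_m (fun j => f (a + n + 1 - j)%nat) 1 n.
Proof.
induction n as [|n IH]; intros a.
- rewrite !sum_n_m_zero by lia. reflexivity.
- rewrite sum_n_m_1_S, sum_Sn_m by lia.
  replace (a + S n)%nat with (S a + n)%nat by lia.
  rewrite IH. replace (S a + n + 1 - S n)%nat with (S a) by lia.
  apply Rplus_comm.
Qed.

Lemma is_series_telescope (v : nat -> R) (l : R) :
  is_lim_seq v l -> is_series (fun k => v (S k) - v k) (l - v O).
Proof.
intros Hv. change (is_lim_seq (sum_n (fun k => v (S k) - v k)) (l - v O)).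
apply is_lim_seq_ext with (fun n => v (S n) - v O).
- induction n as [|n IH].
  + rewrite sum_O. reflexivity.
  + rewrite sum_Sn, <- IH. change plus with Rplus. simpl. ring.
- apply is_lim_seq_minus'.
  + apply (is_lim_seq_incr_1 v); exact Hv.
  + apply is_lim_seq_const.
Qed.

Lemma is_lim_seq_const_div_S (c : R) : is_lim_seq (fun n => c / (INR n + 1)) 0.
Proof.
replace 0 with (c * 0) by ring. apply is_lim_seq_mult'.
- apply is_lim_seq_const.
- apply is_lim_seq_ext with (fun n => / INR (S n)).
  + intros n. rewrite S_INR. reflexivity.
  + apply (is_lim_seq_incr_1 (fun n => / INR n)).
    apply (is_lim_seq_inv INR p_infty); [apply is_lim_seq_INR | discriminate].
Qed.

Lemma is_lim_seq_0_of_bound (u : nat -> R) (c : R) :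
  (forall n, Rabs (u n) <= c / (INR n + 1)) -> is_lim_seq u 0.
Proof.
intros Hu. apply is_lim_seq_abs_0.
apply is_lim_seq_le_le with (fun _ => 0) (fun n => c / (INR n + 1)).
- intros n. split; [apply Rabs_pos | apply Hu].
- apply is_lim_seq_const.
- apply is_lim_seq_const_div_S.
Qed.

(** Partial fractions: the term is the increment of - c / (k + 1). This series is the majorant in
    every comparison below. *)
Lemma is_series_inv_mul_succ (c : R) :
  is_series (fun k => c / ((INR k + 1) * (INR k + 2))) c.
Proof.
pose proof (is_series_telescope (fun k => - c / (INR k + 1)) 0
              (is_lim_seq_const_div_S _)) as H.
cbv beta in H.
replace (0 - - c / (INR 0 + 1)) with c in H by (simpl; field).
revert H. apply is_series_ext. intros k. rewrite S_INR.
pose proof (pos_INR k).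
match goal with |- ?a = ?b => change (a = b :> R) end. field. lra.
Qed.

(** [Series] is total, so [zeta] carries no convergence by itself; comparison with a telescoping
    series supplies it. *)
Lemma is_series_zeta_2 : is_series (fun k => / INR (S k) ^ 2) (zeta 2).
Proof.
replace (zeta 2) with (Series (fun k => / INR (S k) ^ 2)).
- apply Series_correct.
  apply (ex_series_le (V := R_CompleteNormedModule) _
           (fun k => 2 / ((INR k + 1) * (INR k + 2)))).
  + intros k. change norm with Rabs. rewrite S_INR. pose proof (pos_INR k).
    rewrite Rabs_pos_eq by (left; apply Rinv_0_lt_compat, pow_lt; lra).
    apply Rminus_le_0.
    replace (2 / ((INR k + 1) * (INR k + 2)) - / (INR k + 1) ^ 2)
      with (INR k / ((INR k + 1) ^ 2 * (INR k + 2))) by (field; lra).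
    apply Rdiv_le_0_compat; [lra | apply Rmult_lt_0_compat; [apply pow_lt|]; lra].
  + eexists. apply is_series_inv_mul_succ.
- apply Series_ext. intros k. f_equal.
  replace 2 with (INR 2) by (simpl; ring).
  symmetry. apply Rpower_pow, lt_0_INR. lia.
Qed.

Lemma O2_S (m : nat) : O2 (S m) = O2 m + / (2 * INR m + 1) ^ 2.
Proof.
unfold O2. rewrite sum_n_m_1_S, S_INR. do 3 f_equal. ring.
Qed.

Lemma O2_0 : O2 0 = 0.
Proof. exact (sum_n_m_zero _ 1 0 Nat.lt_0_1). Qed.

(** The left side runs over 1, ..., 2n + 2, since [sum_n] includes both end indices. The odd numbers
    give [O2 (S n)], and the even ones a quarter of the sum over 1, ..., n + 1. *)
Lemma sum_inv_sq_odd_even (n : nat) :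
  sum_n (fun k => / INR (S k) ^ 2) (2 * n + 1) =
  O2 (S n) + sum_n (fun k => / INR (S k) ^ 2) n / 4.
Proof.
induction n as [|n IH].
- rewrite O2_S, O2_0. simpl (2 * 0 + 1)%nat. rewrite sum_Sn, !sum_O.
  change plus with Rplus. simpl. field.
- replace (2 * S n + 1)%nat with (S (S (2 * n + 1))) by lia.
  rewrite !sum_Sn, IH, (O2_S (S n)). change plus with Rplus.
  rewrite !S_INR, plus_INR, mult_INR. pose proof (pos_INR n). simpl.
  field. lra.
Qed.

Lemma eventually_ge_id (phi : nat -> nat) :
  (forall n, (n <= phi n)%nat) -> filterlim phi eventually eventually.
Proof.
intros H P [N HN]. exists N. intros n Hn. apply HN. specialize (H n). lia.
Qed.

Lemma is_lim_O2 : is_lim_seq O2 (3 / 4 * zeta 2).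
Proof.
pose proof is_series_zeta_2 as Hz.
change (is_lim_seq (sum_n (fun k => / INR (S k) ^ 2)) (zeta 2)) in Hz.
apply is_lim_seq_incr_1.
replace (3 / 4 * zeta 2) with (zeta 2 - zeta 2 * / 4) by field.
apply is_lim_seq_ext with
  (fun n => sum_n (fun k => / INR (S k) ^ 2) (2 * n + 1) -
            sum_n (fun k => / INR (S k) ^ 2) n * / 4).
- intros n. rewrite sum_inv_sq_odd_even. field.
- apply is_lim_seq_minus'.
  + apply (is_lim_seq_subseq _ _ (fun n => 2 * n + 1)%nat); [|exact Hz].
    apply eventually_ge_id. intros n. lia.
  + apply is_lim_seq_mult'; [exact Hz | apply is_lim_seq_const].
Qed.

(** * The value of zeta(2) *)

Lemma x_lt_tan (x : R) : 0 < x < PI / 2 -> x < tan x.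
Proof.
intros Hx.
destruct (MVT_cor2 tan (fun y => tan y ^ 2 + 1) 0 x) as [c [Hc Hc']]; [lra| |].
- intros c Hc. apply is_derive_Reals, is_derive_tan.
  apply Rgt_not_eq, cos_gt_0; lra.
- rewrite tan_0 in Hc.
  assert (Hpos : 0 < tan c) by (apply tan_gt_0; lra).
  assert (0 < tan c ^ 2 * x) by (apply Rmult_lt_0_compat; [apply pow_lt|]; lra).
  lra.
Qed.

(** Since 1/sin^2 x - 1 = 1/tan^2 x, this is sin x < x < tan x, inverted and squared. *)
Lemma inv_sin_sq_bounds (x : R) :
  0 < x < PI / 2 -> / sin x ^ 2 - 1 <= / x ^ 2 <= / sin x ^ 2.
Proof.
intros Hx.
assert (Hs : 0 < sin x) by (apply sin_gt_0; lra).
assert (Hc : 0 < cos x) by (apply cos_gt_0; lra).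
split.
- assert (Ht : x < tan x) by (apply x_lt_tan; lra).
  replace (/ sin x ^ 2 - 1) with (/ tan x ^ 2).
  + apply Rinv_le_contravar; [apply pow_lt; lra | apply pow_incr; lra].
  + unfold tan. pose proof (sin2_cos2 x) as H. unfold Rsqr in H.
    apply Rmult_eq_reg_r with (sin x ^ 2); [|apply pow_nonzero; lra].
    transitivity (1 - sin x ^ 2); [|field; lra].
    transitivity (cos x ^ 2); [field; lra | lra].
- apply Rinv_le_contravar; [apply pow_lt; lra | apply pow_incr].
  pose proof (sin_lt_x x). lra.
Qed.

(** The second sine is cos x; over a common denominator the numerator is 1 and the denominator is
    sin^2 x cos^2 x = sin^2 (2x) / 4. *)
Lemma inv_sin_sq_double (x : R) :
  0 < x < PI / 2 ->
  / sin x ^ 2 + / sin (PI / 2 - x) ^ 2 = 4 * / sin (2 * x) ^ 2.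
Proof.
intros Hx.
assert (Hs : 0 < sin x) by (apply sin_gt_0; lra).
assert (Hc : 0 < cos x) by (apply cos_gt_0; lra).
rewrite sin_shift, sin_2a. pose proof (sin2_cos2 x) as H. unfold Rsqr in H.
transitivity ((sin x * sin x + cos x * cos x) / (sin x ^ 2 * cos x ^ 2)).
- field. lra.
- rewrite H. field. lra.
Qed.

(** For j = 1, ..., N these are the odd multiples of pi / (4N) in (0, pi/2), a set symmetric about
    pi/4. *)
Definition odd_angle (N j : nat) : R := (2 * INR j - 1) * PI / (4 * INR N).

Lemma odd_angle_bounds (N j : nat) :
  (1 <= j <= N)%nat -> 0 < odd_angle N j < PI / 2.
Proof.
intros [H1 H2]. pose proof PI_RGT_0 as Hpi.
apply le_INR in H1, H2. simpl (INR 1) in H1. unfold odd_angle. split.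
- apply Rdiv_lt_0_compat; [apply Rmult_lt_0_compat|]; lra.
- apply Rmult_lt_reg_r with (4 * INR N); [lra|].
  replace ((2 * INR j - 1) * PI / (4 * INR N) * (4 * INR N))
    with ((2 * INR j - 1) * PI) by (field; lra).
  replace (PI / 2 * (4 * INR N)) with (2 * INR N * PI) by field.
  apply Rmult_lt_compat_r; lra.
Qed.

(** Angles j and 2N + 1 - j of the finer family add up to pi/2, and twice the j-th one is the j-th
    angle of the coarser family, so each pair falls under [inv_sin_sq_double]. *)
Lemma sum_inv_sin_sq_double (N : nat) : (1 <= N)%nat ->
  sum_n_m (fun j => / sin (odd_angle (2 * N) j) ^ 2) 1 (2 * N) =
  4 * sum_n_m (fun j => / sin (odd_angle N j) ^ 2) 1 N :> R.
Proof.
intros HN.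
set (f := fun j => / sin (odd_angle (2 * N) j) ^ 2).
replace (2 * N)%nat with (N + N)%nat by lia.
rewrite (sum_n_m_Chasles f 1 N (N + N)) by lia.
(* Reversing the upper half aligns each angle with its complement. *)
rewrite sum_n_m_rev, <- sum_n_m_plus.
change 4 with (4 : R_Ring).
etransitivity; [|apply (sum_n_m_mult_l (K := R_Ring))].
apply sum_n_m_ext_loc. intros j Hj.
change (/ sin (odd_angle (2 * N) j) ^ 2 +
  / sin (odd_angle (2 * N) (N + N + 1 - j)) ^ 2 =
  4 * / sin (odd_angle N j) ^ 2).
assert (HN0 : 0 < INR N) by (apply lt_0_INR; lia).
replace (odd_angle N j) with (2 * odd_angle (2 * N) j)
  by (unfold odd_angle; rewrite mult_INR; simpl; field; lra).
replace (odd_angle (2 * N) (N + N + 1 - j)) with (PI / 2 - odd_angle (2 * N) j).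
- apply inv_sin_sq_double, odd_angle_bounds. lia.
- unfold odd_angle. rewrite minus_INR, !plus_INR, mult_INR by lia.
  simpl. field. lra.
Qed.

Lemma sum_inv_sin_sq_pow2 (n : nat) :
  sum_n_m (fun j => / sin (odd_angle (2 ^ n) j) ^ 2) 1 (2 ^ n) =
  2 * INR (2 ^ n) ^ 2 :> R.
Proof.
induction n as [|n IH].
- simpl (2 ^ 0)%nat. rewrite sum_n_n. unfold odd_angle.
  replace ((2 * INR 1 - 1) * PI / (4 * INR 1)) with (PI / 4) by (simpl; field).
  rewrite sin_PI4. pose proof Rlt_sqrt2_0. simpl (INR 1).
  replace ((1 / sqrt 2) ^ 2) with (/ (sqrt 2 * sqrt 2)) by (field; lra).
  rewrite sqrt_sqrt by lra. field.
- rewrite Nat.pow_succ_r', sum_inv_sin_sq_double, IH.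
  + rewrite mult_INR. simpl (INR 2). ring.
  + pose proof (Nat.pow_nonzero 2 n). lia.
Qed.

Lemma sum_n_m_1_le (f g : nat -> R) (n : nat) :
  (forall j, (1 <= j <= n)%nat -> f j <= g j) ->
  sum_n_m f 1 n <= sum_n_m g 1 n.
Proof.
induction n as [|n IH]; intros H.
- rewrite !sum_n_m_zero by lia. apply Rle_refl.
- rewrite !sum_n_m_1_S. apply Rplus_le_compat.
  + apply IH. intros j Hj. apply H. lia.
  + apply H. lia.
Qed.

(** The sum of 1/x^2 over the N angles is 16 N^2 / pi^2 times [O2 N], and the sine bounds place it
    between 2N^2 - N and 2N^2. *)
Lemma O2_pow2_bounds (n : nat) :
  PI ^ 2 / 8 - PI ^ 2 / 16 / INR (2 ^ n) <= O2 (2 ^ n) <= PI ^ 2 / 8.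
Proof.
set (N := (2 ^ n)%nat).
assert (HN : (1 <= N)%nat) by (pose proof (Nat.pow_nonzero 2 n); unfold N; lia).
assert (HN0 : 0 < INR N) by (apply lt_0_INR; lia).
pose proof PI_RGT_0 as Hpi.
assert (E : sum_n_m (fun j => / odd_angle N j ^ 2) 1 N =
            16 * INR N ^ 2 / PI ^ 2 * O2 N).
{ unfold O2. change (16 * INR N ^ 2 / PI ^ 2) with (16 * INR N ^ 2 / PI ^ 2 : R_Ring).
  etransitivity; [|apply (sum_n_m_mult_l (K := R_Ring))].
  apply sum_n_m_ext_loc. intros j [Hj _].
  apply le_INR in Hj. simpl (INR 1) in Hj.
  unfold odd_angle. change mult with Rmult.
  match goal with |- ?a = ?b => change (a = b :> R) end. field. lra. }
assert (Hu : sum_n_m (fun j => / odd_angle N j ^ 2) 1 N <= 2 * INR N ^ 2).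
{ rewrite <- (sum_inv_sin_sq_pow2 n : _ = 2 * INR N ^ 2). apply sum_n_m_1_le.
  intros j Hj. apply inv_sin_sq_bounds, odd_angle_bounds, Hj. }
assert (Hl : 2 * INR N ^ 2 <=
             sum_n_m (fun j => / odd_angle N j ^ 2) 1 N + INR N).
{ rewrite <- (sum_inv_sin_sq_pow2 n : _ = 2 * INR N ^ 2).
  (* One unit for each angle absorbs the -1 in the lower sine bound. *)
  replace (INR N) with (sum_n_m (fun _ => 1) 1 N)
    by (rewrite sum_n_m_const; replace (S N - 1)%nat with N by lia;
        apply Rmult_1_r).
  etransitivity; [|right; apply (sum_n_m_plus (G := R_AbelianMonoid))].
  apply sum_n_m_1_le. intros j Hj.
  pose proof (inv_sin_sq_bounds _ (odd_angle_bounds N j Hj)).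
  change (/ sin (odd_angle N j) ^ 2 <= / odd_angle N j ^ 2 + 1). lra. }
rewrite E in Hu, Hl.
assert (Hk : 0 < PI ^ 2 / (16 * INR N ^ 2))
  by (apply Rdiv_lt_0_compat; [|apply Rmult_lt_0_compat; [lra|]]; apply pow_lt; lra).
apply (Rmult_le_compat_l _ _ _ (Rlt_le _ _ Hk)) in Hu, Hl.
replace (PI ^ 2 / (16 * INR N ^ 2) * (16 * INR N ^ 2 / PI ^ 2 * O2 N))
  with (O2 N) in Hu by (field; lra).
replace (PI ^ 2 / (16 * INR N ^ 2) * (16 * INR N ^ 2 / PI ^ 2 * O2 N + INR N))
  with (O2 N + PI ^ 2 / 16 / INR N) in Hl by (field; lra).
replace (PI ^ 2 / (16 * INR N ^ 2) * (2 * INR N ^ 2))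
  with (PI ^ 2 / 8) in Hu, Hl by (field; lra).
lra.
Qed.

Lemma zeta_2 : zeta 2 = PI ^ 2 / 6.
Proof.
(* Serves twice: powers of 2 give a subsequence, and the error pi^2 / (16 * 2^n) is dominated by one
   over n + 1. *)
assert (Hid : forall n, (n + 1 <= 2 ^ n)%nat).
{ induction n as [|n IH]; simpl; lia. }
assert (H1 : is_lim_seq (fun n => O2 (2 ^ n)) (3 / 4 * zeta 2)).
{ apply is_lim_seq_subseq; [|apply is_lim_O2].
  apply eventually_ge_id. intros n. specialize (Hid n). lia. }
assert (H2 : is_lim_seq (fun n => O2 (2 ^ n)) (PI ^ 2 / 8)).
{ apply is_lim_seq_le_le with
    (fun n => PI ^ 2 / 8 - PI ^ 2 / 16 / (INR n + 1)) (fun _ => PI ^ 2 / 8).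
  - intros n. destruct (O2_pow2_bounds n) as [Hl Hu]. split; [|exact Hu].
    apply Rle_trans with (2 := Hl), Rplus_le_compat_l, Ropp_le_contravar.
    specialize (Hid n). apply le_INR in Hid. rewrite plus_INR in Hid.
    simpl (INR 1) in Hid. pose proof (pos_INR n).
    apply Rmult_le_compat_l; [|apply Rinv_le_contravar; lra].
    pose proof (pow2_ge_0 PI). lra.
  - pose proof (is_lim_seq_minus' _ _ _ _ (is_lim_seq_const (PI ^ 2 / 8))
                  (is_lim_seq_const_div_S (PI ^ 2 / 16))) as H.
    rewrite Rminus_0_r in H. exact H.
  - apply is_lim_seq_const. }
apply is_lim_seq_unique in H1, H2. rewrite H1 in H2. injection H2 as H2. lra.
Qed.

(** * The Wilf-Zeilberger pair *)

Lemma INR_fact_S (n : nat) : INR (fact (S n)) = (INR n + 1) * INR (fact n).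
Proof. rewrite fact_simpl, mult_INR, S_INR. reflexivity. Qed.

Lemma binom_pos (n k : nat) : 0 < binom n k.
Proof.
apply Rdiv_lt_0_compat; [|apply Rmult_lt_0_compat]; apply INR_fact_lt_0.
Qed.

Lemma binom_central_S (n : nat) :
  binom (2 * S n) (S n) =
  binom (2 * n) n * (2 * (2 * INR n + 1) / (INR n + 1)).
Proof.
unfold binom.
replace (2 * S n - S n)%nat with (S n) by lia.
replace (2 * n - n)%nat with n by lia.
replace (2 * S n)%nat with (S (S (2 * n))) by lia.
rewrite !INR_fact_S, S_INR, mult_INR. simpl (INR 2).
pose proof (INR_fact_neq_0 n). pose proof (pos_INR n). field. lra.
Qed.

Lemma binom_add_S_l (n m : nat) :
  binom (S n + m) m = binom (n + m) m * ((INR n + INR m + 1) / (INR n + 1)).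
Proof.
unfold binom.
replace (S n + m - m)%nat with (S n) by lia.
replace (n + m - m)%nat with n by lia.
rewrite plus_Sn_m, !INR_fact_S, plus_INR.
pose proof (INR_fact_neq_0 n). pose proof (INR_fact_neq_0 m).
pose proof (pos_INR n). field. lra.
Qed.

Lemma binom_add_S_r (n m : nat) :
  binom (n + S m) (S m) = binom (n + m) m * ((INR n + INR m + 1) / (INR m + 1)).
Proof.
unfold binom.
replace (n + S m - S m)%nat with n by lia.
replace (n + m - m)%nat with n by lia.
rewrite <- plus_n_Sm, !INR_fact_S, plus_INR.
pose proof (INR_fact_neq_0 n). pose proof (INR_fact_neq_0 m).
pose proof (pos_INR m). field. lra.
Qed.

(** The value is -1 at m = 0 and at least 3 afterwards, so no fixed sign is available. *)
Lemma four_sq_minus_1_neq_0 (m : nat) : 4 * INR m ^ 2 - 1 <> 0.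
Proof.
destruct m as [|m]; [simpl; lra|].
rewrite S_INR. pose proof (pos_INR m). nra.
Qed.

Definition summand (m n : nat) : R :=
  2 ^ (2 * n) /
  (INR n * (INR n + 1) * (INR n + 2) *
   binom (2 * (n + m)) (n + m) * binom (n + m) m).

(* F(m, k + 1) in the notation of the header. *)
Definition wz (m k : nat) : R :=
  8 * binom (2 * m) m / (4 * INR m ^ 2 - 1) * summand m (S k).

(** The term ratios, in k here and in m below, are rational, which reduces [wz_equation] to an
    identity of rational functions. *)
Lemma wz_k_S (m k : nat) :
  wz m (S k) =
  wz m k * (2 * (INR k + 1) * (INR k + 2) /
            ((INR k + 4) * (2 * INR k + 2 * INR m + 3))).
Proof.
unfold wz, summand.
replace (2 * S (S k))%nat with (2 * S k + 2)%nat by lia.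
rewrite (plus_Sn_m (S k) m), binom_central_S.
rewrite <- (plus_Sn_m (S k) m), (binom_add_S_l (S k)), pow_add, plus_INR, !S_INR.
pose proof (binom_pos (2 * (S k + m)) (S k + m)).
pose proof (binom_pos (S k + m) m).
pose proof (pos_INR k). pose proof (pos_INR m).
pose proof (four_sq_minus_1_neq_0 m).
field. repeat split; lra.
Qed.

Lemma wz_m_S (m k : nat) :
  wz (S m) k =
  wz m k * ((4 * INR m ^ 2 - 1) /
            ((2 * INR k + 2 * INR m + 3) * (2 * INR m + 3))).
Proof.
unfold wz, summand.
rewrite binom_add_S_r, <- (plus_n_Sm (S k) m), !binom_central_S.
rewrite plus_INR, !S_INR.
pose proof (binom_pos (2 * (S k + m)) (S k + m)).
pose proof (binom_pos (S k + m) m).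
pose proof (pos_INR k). pose proof (pos_INR m).
pose proof (four_sq_minus_1_neq_0 m).
assert (4 * (INR m + 1) ^ 2 - 1 <> 0) by nra.
field. repeat split; try lra; nra.
Qed.

Lemma wz_0 (m : nat) :
  wz m 0 = 8 / (3 * (2 * INR m + 1) * (4 * INR m ^ 2 - 1)).
Proof.
unfold wz, summand.
replace (1 + m)%nat with (S m) by lia.
rewrite binom_central_S.
replace (S m) with (1 + m)%nat by lia. rewrite (binom_add_S_l 0).
replace (binom (0 + m) m) with 1.
- pose proof (binom_pos (2 * m) m).
  pose proof (pos_INR m). pose proof (four_sq_minus_1_neq_0 m).
  simpl (INR 1). simpl (INR 0). simpl (2 ^ (2 * 1)). field.
  repeat split; try lra; nra.
- simpl (0 + m)%nat. unfold binom. rewrite Nat.sub_diag. simpl (fact 0).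
  simpl (INR 1). pose proof (INR_fact_neq_0 m). field. assumption.
Qed.

(** The Wilf-Zeilberger mate, with the factor 2 (n + 2) / (2m + 3) taken at n = k + 1. *)
Definition wz_cert (m k : nat) : R :=
  2 * (INR k + 3) / (2 * INR m + 3) * wz m k.

Lemma wz_equation (m k : nat) :
  wz_cert m (S k) - wz_cert m k = wz (S m) k - wz m k.
Proof.
unfold wz_cert. rewrite wz_m_S, wz_k_S, S_INR.
pose proof (pos_INR k). pose proof (pos_INR m).
field. repeat split; lra.
Qed.

(** The term ratio in k is at most (k + 1) / (k + 3), which is exactly the ratio of the majorant.
    The dependence on m is confined to [wz m 0], as the limit in m requires. *)
Lemma wz_bound (m k : nat) :
  Rabs (wz m k) <= 2 * Rabs (wz m 0) / ((INR k + 1) * (INR k + 2)).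
Proof.
induction k as [|k IH].
- simpl (INR 0). right. field.
- pose proof (pos_INR k) as Hk. pose proof (pos_INR m) as Hm.
  set (r := 2 * (INR k + 1) * (INR k + 2) /
            ((INR k + 4) * (2 * INR k + 2 * INR m + 3))).
  assert (Hr : 0 <= r <= (INR k + 1) / (INR k + 3)).
  { unfold r. split; [apply Rdiv_le_0_compat; nra|].
    apply Rmult_le_reg_r with
      ((INR k + 4) * (2 * INR k + 2 * INR m + 3) * (INR k + 3)); [nra|].
    field_simplify; [nra|lra|nra]. }
  rewrite wz_k_S, S_INR. fold r. rewrite Rabs_mult, (Rabs_pos_eq r) by lra.
  apply Rle_trans with
    (2 * Rabs (wz m 0) / ((INR k + 1) * (INR k + 2)) *
     ((INR k + 1) / (INR k + 3))).
  + apply Rmult_le_compat; try lra. apply Rabs_pos.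
  + right. field. lra.
Qed.

(** * Summation of the pair and the limit in m *)

Lemma ex_series_wz (m : nat) : ex_series (wz m).
Proof.
apply (ex_series_le (V := R_CompleteNormedModule) _ _ (wz_bound m)).
eexists. apply is_series_inv_mul_succ.
Qed.

Lemma wz_cert_lim (m : nat) : is_lim_seq (wz_cert m) 0.
Proof.
apply is_lim_seq_0_of_bound with (4 * Rabs (wz m 0)). intros k.
pose proof (pos_INR k). pose proof (pos_INR m). pose proof (Rabs_pos (wz m 0)).
unfold wz_cert. rewrite Rabs_mult.
rewrite Rabs_pos_eq by (apply Rdiv_le_0_compat; lra).
(* The crude estimate 2 (k + 3) / (2m + 3) <= 2 (k + 2) cancels one factor of the majorant. *)
apply Rle_trans with
  (2 * (INR k + 2) * (2 * Rabs (wz m 0) / ((INR k + 1) * (INR k + 2)))).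
- apply Rmult_le_compat; [apply Rdiv_le_0_compat; lra|apply Rabs_pos| |apply wz_bound].
  apply Rmult_le_reg_r with (2 * INR m + 3); [lra|].
  field_simplify; [nra|lra].
- right. field. lra.
Qed.

(** Summing [wz_equation] over k telescopes; as the mate tends to 0, only - [wz_cert m 0]
    remains. *)
Lemma Series_wz_S (m : nat) :
  Series (wz (S m)) - Series (wz m) =
  - 16 / ((2 * INR m - 1) * (2 * INR m + 1) ^ 2 * (2 * INR m + 3)).
Proof.
rewrite <- Series_minus by apply ex_series_wz.
rewrite (Series_ext _ (fun k => wz_cert m (S k) - wz_cert m k))
  by (intros k; symmetry; apply wz_equation).
rewrite (is_series_unique _ _ (is_series_telescope _ _ (wz_cert_lim m))).
unfold wz_cert. rewrite wz_0.
pose proof (pos_INR m). pose proof (four_sq_minus_1_neq_0 m) as H4.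
simpl (INR 0). replace (4 * INR m ^ 2 - 1) with ((2 * INR m - 1) * (2 * INR m + 1)) in * by ring.
assert (2 * INR m - 1 <> 0) by (intros E; apply H4; rewrite E; ring).
field. repeat split; lra.
Qed.

(** Summing [wz_bound] over k bounds the series by 2 |[wz m 0]|, and the closed form [wz_0] tends to
    0. *)
Lemma Series_wz_lim : is_lim_seq (fun m => Series (wz m)) 0.
Proof.
apply is_lim_seq_0_of_bound with (16 / 3). intros m.
apply Rle_trans with (2 * Rabs (wz m 0)).
- rewrite <- (is_series_unique _ _ (is_series_inv_mul_succ (2 * Rabs (wz m 0)))).
  apply Rle_trans with (Series (fun k => Rabs (wz m k))).
  + apply Series_Rabs.
    apply (ex_series_le (V := R_CompleteNormedModule) _
      (fun k => 2 * Rabs (wz m 0) / ((INR k + 1) * (INR k + 2)))).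
    * intros k. change norm with Rabs. rewrite Rabs_Rabsolu. apply wz_bound.
    * eexists. apply is_series_inv_mul_succ.
  + apply Series_le.
    * intros k. split; [apply Rabs_pos | apply wz_bound].
    * eexists. apply is_series_inv_mul_succ.
- pose proof (pos_INR m).
  assert (1 <= Rabs (4 * INR m ^ 2 - 1)).
  { destruct m as [|m].
    - simpl. rewrite Rabs_left; lra.
    - rewrite S_INR in *. pose proof (pos_INR m). rewrite Rabs_pos_eq; nra. }
  rewrite wz_0. unfold Rdiv at 1.
  rewrite Rabs_mult, Rabs_inv, !Rabs_mult, !(Rabs_pos_eq 8), !(Rabs_pos_eq 3),
    (Rabs_pos_eq (2 * INR m + 1)) by lra.
  replace (16 / 3 / (INR m + 1)) with (2 * (8 * / (3 * (INR m + 1) * 1)))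
    by (field; lra).
  do 2 (apply Rmult_le_compat_l; [lra|]).
  apply Rinv_le_contravar; [lra|].
  apply Rmult_le_compat; lra.
Qed.

(** By partial fractions the increment in [Series_wz_S] is 4 / (2m + 1)^2, the increment of 4 [O2],
    plus the increment of 4m / (4m^2 - 1). *)
Lemma Series_wz (m : nat) :
  Series (wz m) = 4 * O2 m - 3 * zeta 2 + 4 * INR m / (4 * INR m ^ 2 - 1).
Proof.
set (d := fun m => Series (wz m) - 4 * O2 m - 4 * INR m / (4 * INR m ^ 2 - 1)).
assert (Hconst : forall n, d n = d O).
{ induction n as [|n IH]; [reflexivity|]. rewrite <- IH. unfold d.
  rewrite O2_S, S_INR.
  replace (Series (wz (S n))) with
    (Series (wz n) + (Series (wz (S n)) - Series (wz n))) by ring.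
  rewrite Series_wz_S.
  pose proof (pos_INR n). pose proof (four_sq_minus_1_neq_0 n) as H4.
  assert (2 * INR n - 1 <> 0)
    by (intros E; apply H4; replace (INR n) with (/ 2) by lra; field).
  assert (4 * (INR n + 1) ^ 2 - 1 <> 0) by nra.
  field. repeat split; lra. }
assert (Hd : is_lim_seq d (- 3 * zeta 2)).
{ replace (- 3 * zeta 2) with (0 - 4 * (3 / 4 * zeta 2) - 0) by field.
  repeat apply is_lim_seq_minus'.
  - apply Series_wz_lim.
  - apply is_lim_seq_mult'; [apply is_lim_seq_const | apply is_lim_O2].
  (* For m >= 1 the bound 4m / (4m^2 - 1) <= 4 / (m + 1) holds; m = 0 is separate because the
     denominator is negative there. *)
  - apply is_lim_seq_0_of_bound with 4. intros [|n].
    + simpl. unfold Rdiv. rewrite Rmult_0_r, Rmult_0_l, Rabs_R0. lra.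
    + rewrite S_INR. pose proof (pos_INR n).
      rewrite Rabs_pos_eq by (apply Rdiv_le_0_compat; nra).
      apply Rmult_le_reg_r with
        ((4 * (INR n + 1) ^ 2 - 1) * (INR n + 1 + 1)); [nra|].
      field_simplify; [nra|lra|nra]. }
apply is_lim_seq_ext with (v := fun _ => d O) in Hd; [|exact Hconst].
apply is_lim_seq_unique in Hd. rewrite Lim_seq_const in Hd.
injection Hd as Hd. rewrite <- (Hconst m) in Hd. unfold d in Hd. lra.
Qed.

(** * The series of the theorem and its special cases *)

Lemma is_series1_summand (m : nat) :
  is_series1 (summand m)
    (1 / (2 * binom (2 * m) m) *
     ((INR m - 1 / 2) * (INR m + 1 / 2) * (4 * O2 m - 3 * zeta 2) + INR m)).
Proof.
pose proof (four_sq_minus_1_neq_0 m). pose proof (binom_pos (2 * m) m).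
(* The inverse of the normalising factor in [wz]. *)
set (c := (4 * INR m ^ 2 - 1) / (8 * binom (2 * m) m)).
replace (1 / (2 * binom (2 * m) m) * _) with (c * Series (wz m))
  by (rewrite Series_wz; unfold c; field; lra).
apply is_series_ext with (fun k => c * wz m k).
- intros k. match goal with |- ?a = ?b => change (a = b :> R) end.
  unfold wz, c. field. lra.
- exact (is_series_scal_l c _ _ (Series_correct _ (ex_series_wz m))).
Qed.

(** Agreement is asked only for n >= 1, where the denominators do not vanish. *)
Lemma is_series1_special (m : nat) (b : nat -> R) (l : R) :
  (forall k, summand m (S k) = b (S k)) ->
  1 / (2 * binom (2 * m) m) *
    ((INR m - 1 / 2) * (INR m + 1 / 2) * (4 * O2 m - 3 * zeta 2) + INR m) = l ->
  is_series1 b l.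
Proof.
intros H <-. apply is_series_ext with (1 := H), is_series1_summand.
Qed.

Lemma binom_0_r (n : nat) : binom (n + 0) 0 = 1.
Proof.
unfold binom. rewrite Nat.add_0_r, Nat.sub_0_r. simpl (INR (fact 0)).
pose proof (INR_fact_neq_0 n). field. assumption.
Qed.

Theorem theorem10 :
  (forall m : nat,
     is_series1
       (fun n : nat =>
          2 ^ (2 * n) /
          (INR n * (INR n + 1) * (INR n + 2) *
           binom (2 * (n + m)) (n + m) * binom (n + m) m))
       (1 / (2 * binom (2 * m) m) *
        ((INR m - 1 / 2) * (INR m + 1 / 2) * (4 * O2 m - 3 * zeta 2) + INR m)))
  /\
  is_series1
    (fun n : nat =>
       2 ^ (2 * n) /
       (INR n * (INR n + 1) * (INR n + 2) * binom (2 * n) n))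
    (PI ^ 2 / 16)
  /\
  is_series1
    (fun n : nat =>
       2 ^ (2 * n) /
       (INR n * (INR n + 1) ^ 2 * (INR n + 2) * binom (2 * (n + 1)) (n + 1)))
    (1 - 3 * PI ^ 2 / 32)
  /\
  is_series1
    (fun n : nat =>
       2 ^ (2 * n + 1) /
       (INR n * (INR n + 1) ^ 2 * (INR n + 2) ^ 2 *
        binom (2 * (n + 2)) (n + 2)))
    (14 / 9 - 5 * PI ^ 2 / 32).

Proof.
pose proof (binom_0_r 0 : binom (2 * 0) 0 = 1) as B0.
split; [exact is_series1_summand|split; [|split]].
- apply (is_series1_special 0).
  + intros k. unfold summand. rewrite binom_0_r, Nat.add_0_r, Rmult_1_r.
    reflexivity.
  + rewrite O2_0, zeta_2, B0. simpl. field.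
- apply (is_series1_special 1).
  + intros k. unfold summand. rewrite binom_add_S_r, binom_0_r.
    pose proof (binom_pos (2 * (S k + 1)) (S k + 1)).
    rewrite S_INR. pose proof (pos_INR k). simpl (INR 0).
    field. lra.
  + rewrite O2_S, O2_0, zeta_2, binom_central_S, B0. simpl. field.
- apply (is_series1_special 2).
  (* The binomial coefficient of n + 2 over 2 is (n + 1)(n + 2) / 2; its 2 turns 2^(2n) into 2^(2n +
     1). *)
  + intros k. unfold summand. rewrite !binom_add_S_r, binom_0_r, pow_add.
    pose proof (binom_pos (2 * (S k + 2)) (S k + 2)).
    rewrite S_INR. pose proof (pos_INR k). simpl (INR 0). simpl (INR 1).
    field. lra.
  + rewrite !O2_S, O2_0, zeta_2, !binom_central_S, B0. simpl. field.
Qed.
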